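(* Let $\Sigma$ be a set of $m$ matrices in $\mathbb{R}^{n\times n}$, at most one of which has rank greater than one. Then $\Sigma$ has the oligo-vertex property, and $N_k(\Sigma)=O(mk)$.
   Context: For a finite set $\Sigma$ of real $n\times n$ matrices, a vector $a\in\mathbb{R}^n$ and an integer $k\ge0$, let $P_k(\Sigma,a)=\mathrm{conv}\{T_{k-1}\cdots T_0a\mid T_j\in\Sigma,\ j=0,\ldots,k-1\}$ (convex hull), let $N_k(\Sigma,a)$ be the number of extreme points of $P_k(\Sigma,a)$, and let $N_k(\Sigma)=\sup_{a\in\mathbb{R}^n}N_k(\Sigma,a)$. The set $\Sigma$ has the oligo-vertex property if there exist $\alpha>0$, a positive integer $k_0$ and a positive constant $d$ such that $N_k(\Sigma)\le\alpha k^d$ for all $k\ge k_0$. Big-O notation is as $k\to\infty$. *)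

(* Defs.v *)
From HB Require Import structures.
From mathcomp Require Import all_boot all_order all_algebra finmap.
From mathcomp Require Import all_classical all_reals all_analysis.

Set Implicit Arguments.
Unset Strict Implicit.
Unset Printing Implicit Defensive.

Import Order.TTheory GRing.Theory Num.Theory.

Local Open Scope classical_set_scope.
Local Open Scope ring_scope.

Section Convexity.
Context {R : realType} {E : lmodType R}.

Definition conv_hull (X : set E) : set E :=
  smallest (fun A : set (convex_lmodType E) => convex_set A) X.

Definition extreme_points (P : set E) : set E :=
  [set x | P x /\
     forall (y z : E) (t : R), P y -> P z -> 0 < t < 1 ->
       x = t *: y + (1 - t) *: z -> y = x /\ z = x].

End Convexity.

Section OligoVertex.
Context {R : realType} {n : nat}.
Implicit Types (Sigma : {fset 'M[R]_n}) (a : 'cV[R]_n) (T : nat -> 'M[R]_n).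

(* [apply_word T a k] is $T_{k-1} \cdots T_0 a$. *)
Fixpoint apply_word T a (k : nat) : 'cV[R]_n :=
  if k is j.+1 then T j *m apply_word T a j else a.

(* Only the letters $T_0, \dots, T_{k-1}$ are constrained; the rest of the
   sequence is irrelevant. *)
Definition orbit_points Sigma a (k : nat) : set 'cV[R]_n :=
  [set x | exists T, (forall j, (j < k)%N -> T j \in Sigma) /\
                     x = apply_word T a k].

Definition P_ Sigma a (k : nat) : set 'cV[R]_n :=
  conv_hull (orbit_points Sigma a k).

(* The count and the supremum take values in the extended reals, so that an
   infinite count or an unbounded supremum would be +oo and not a default
   value. *)
Definition N_at Sigma a (k : nat) : \bar R :=
  counting (extreme_points (P_ Sigma a k)).

Definition N_ Sigma (k : nat) : \bar R :=
  ereal_sup [set N_at Sigma a k | a in [set: 'cV[R]_n]].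

Definition oligo_vertex Sigma : Prop :=
  exists (alpha : R) (k0 : nat) (d : R),
    [/\ 0 < alpha, (0 < k0)%N, 0 < d &
        forall k, (k0 <= k)%N -> (N_ Sigma k <= (alpha * k%:R `^ d)%:E)%E].

End OligoVertex.

(* Main.v *)
Require Import Defs.
From mathcomp Require Import all_boot all_order all_algebra finmap.
From mathcomp Require Import all_classical all_reals all_analysis.
From mathcomp Require Import ring.

Set Implicit Arguments.
Unset Strict Implicit.
Unset Printing Implicit Defensive.

Import Order.TTheory GRing.Theory Num.Theory.

Local Open Scope classical_set_scope.
Local Open Scope ring_scope.

(* Let A be the letter of rank greater than one, if there is one. A word other
   than A^k has a last letter B of rank at most one, in position j say, and then
   the point it produces lies on the line spanned by A^(k-1-j) u, where u spans
   the image of B. There are at most m k such lines; an extreme point of the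
   convex hull is one of the generating points, and no line carries more than
   two extreme points, whence at most 1 + 2 m k <= 3 m k extreme points. *)

Lemma extreme_points_conv_hull (R : realType) (E : lmodType R) (X : set E) :
  extreme_points (conv_hull X) `<=` X.
Proof.
move=> x [hx extx]; apply: contrapT => nXx.
(* By extremality the hull minus [x] is still convex, and it contains [X]. *)
suff sub : conv_hull X `<=` conv_hull X `\ x by have [_] := sub x hx; apply.
apply: smallest_sub => [|y Xy]; last first.
  by split=> [|yx]; [exact: sub_gen_smallest | apply: nXx; rewrite -yx].
apply/convex_setW => y z /set_mem[hy yx] /set_mem[hz zx] t t0 t1.
apply/mem_set; split=> [A hA|/esym e].
  by apply/set_mem; apply: (hA.1); apply/mem_set; [exact: hy|exact: hz].
by have [] := extx y z t%:num hy hz; rewrite ?t0.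
Qed.

(** The middle point is a proper convex combination of the outer two, so extremality identifies
    [a *: w] with [b *: w], which forces [w = 0] as [a < b]. *)
Lemma extreme_point_between (R : realType) (E : lmodType R) (P : set E) (w : E)
    (a b c : R) :
  P (a *: w) -> extreme_points P (b *: w) -> P (c *: w) -> a < b -> b < c ->
  w = 0.
Proof.
move=> Pa [_ extb] Pc ab bc.
have ac : a < c := lt_trans ab bc.
(* The weight solves [b = t * a + (1 - t) * c] for [t]. *)
have [| |+ _] := extb _ _ ((c - b) / (c - a)) Pa Pc.
- by rewrite divr_gt0 ?ltr_pdivrMr ?subr_gt0 ?mul1r ?ltrD2l ?ltrN2 ?ab.
- by rewrite !scalerA -scalerDl; congr (_ *: _); field; rewrite subr_eq0 gt_eqF.
move/eqP; rewrite -subr_eq0 -scalerBl scaler_eq0 subr_eq0 lt_eqF//=.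
by move/eqP.
Qed.

(** Among three distinct multiples of a nonzero [w], one lies strictly between the others. The pair
    is chosen before [s], so that it can become a function of [w]; its entries may be padding. *)
Lemma extreme_points_line (R : realType) (E : lmodType R) (P : set E) (w : E) :
  exists p : E * E, forall s : R, extreme_points P (s *: w) ->
    s *: w = p.1 \/ s *: w = p.2.
Proof.
have [->|w0] := eqVneq w 0.
  by exists (0, 0) => s _; left; rewrite scaler0.
have btw a b c : extreme_points P (a *: w) -> extreme_points P (b *: w) ->
    extreme_points P (c *: w) -> a < b -> b < c -> False.
  move=> [Pa _] Eb [Pc _] ab bc.
  by move/eqP: w0; apply; exact: (extreme_point_between Pa Eb Pc).
have [[a Ea]|noE] := pselect (exists a, extreme_points P (a *: w)); last first.
  by exists (0, 0) => s Es; exfalso; apply: noE; exists s.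
have [[b [Eb ab]]|eqa] := pselect (exists b, extreme_points P (b *: w) /\ a != b).
  exists (a *: w, b *: w) => s Es /=.
  have [->|] := eqVneq s a; first by left.
  have [->|] := eqVneq s b; first by right.
  move: ab; rewrite !neq_lt => ab sb sa; exfalso.
  (* Six sign patterns are the orderings of [a], [b], [s]; the other two are cyclic and contradict
     transitivity. *)
  move: ab sb sa => /orP[ab|ab] /orP[sb|sb] /orP[sa|sa].
  - exact: (btw s a b).
  - exact: (btw a s b).
  - by have := lt_trans (lt_trans ab sb) sa; rewrite ltxx.
  - exact: (btw a b s).
  - exact: (btw s b a).
  - by have := lt_trans (lt_trans ab sa) sb; rewrite ltxx.
  - exact: (btw b s a).
  - exact: (btw b a s).
exists (a *: w, a *: w) => s Es; left => /=.
by have [->//|sa] := eqVneq a s; exfalso; apply: eqa; exists s.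
Qed.

Lemma rank_le1_image (F : fieldType) (m n : nat) (B : 'M[F]_(m, n)) :
  (\rank B <= 1)%N ->
  exists u : 'cV[F]_m, forall x : 'cV[F]_n, exists s, B *m x = s *: u.
Proof.
(* Rank factorisation [B = C *m D]: with inner dimension 1, [C] spans the image and [D *m x] is a
   scalar. *)
rewrite -{2}(mulmx_base B).
move: (\rank B) (col_base B) (row_base B) => [|[|//]] C D _.
  by exists 0 => x; exists 0; rewrite -mulmxA [C]thinmx0 mul0mx scaler0.
exists C => x; exists ((D *m x) 0 0).
by rewrite -mulmxA {1}[D *m x]mx11_scalar mul_mx_scalar.
Qed.

Lemma counting_le_size (R : realType) (T : choiceType) (X : set T) (s : seq T) :
  X `<=` [set` s] -> (counting X <= (size s)%:R%:E :> \bar R)%E.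
Proof.
move=> Xs; have finX : finite_set X := sub_finite_set Xs (finite_seq s).
rewrite /counting; case: asboolP => // _; rewrite lee_fin ler_nat.
apply: uniq_leq_size; first exact: fset_uniq.
by move=> x; rewrite in_fset_set// inE => /Xs.
Qed.

(** Here [j] is the position of the last letter other than [A], and [x] is the point produced by the
    letters before it. *)
Lemma apply_word_factor (R : realType) (n : nat) (A : 'M[R]_n)
    (T : nat -> 'M[R]_n) (a : 'cV[R]_n) (k : nat) :
  apply_word T a k = iter k (mulmx A) a \/
  exists j (x : 'cV[R]_n), [/\ (j < k)%N, T j != A &
    apply_word T a k = iter (k - j.+1) (mulmx A) (T j *m x)].
Proof.
elim: k => [|k IHk]; first by left.
have [TA|TnA] := eqVneq (T k) A; last first.
  by right; exists k, (apply_word T a k); rewrite subnn.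
case: IHk => [E|[j [x [jk TjA E]]]].
  by left; rewrite /= TA E.
right; exists j, x; split=> //; first exact: ltnW.
by rewrite /= TA E subSS -(subnSK jk).
Qed.

Lemma iter_mulmxZ (R : comPzRingType) (m n : nat) (A : 'M[R]_m) (k : nat)
    (s : R) (x : 'M[R]_(m, n)) :
  iter k (mulmx A) (s *: x) = s *: iter k (mulmx A) x.
Proof. by elim: k => //= k ->; rewrite -scalemxAr. Qed.

Lemma N_at_le (R : realType) (n : nat) (Sigma : {fset 'M[R]_n}) (A : 'M[R]_n)
    (a : 'cV[R]_n) (k : nat) :
  (forall B, B \in Sigma -> B != A -> (\rank B <= 1)%N) -> (0 < k)%N ->
  (N_at Sigma a k <= (3 * (#|` Sigma| * k)%:R)%:E)%E.
Proof.
move=> rank_le1 k0; rewrite /N_at; set E := extreme_points _.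
have Eorbit : E `<=` orbit_points Sigma a k by exact: extreme_points_conv_hull.
(* Without letters there is no word of positive length. Otherwise [m * k] is positive, which lets
   the final count absorb the extra 1. *)
have [Sigma0|Sigma_gt0] := posnP #|` Sigma|.
  rewrite Sigma0 mul0n mulr0; apply: (@counting_le_size _ _ _ [::]).
  by move=> x /Eorbit [T [/(_ 0%N k0)]]; rewrite (cardfs0_eq Sigma0) inE.
have /choice[u uP] : forall B, exists u : 'cV[R]_n, B \in Sigma -> B != A ->
    forall x : 'cV[R]_n, exists s, B *m x = s *: u.
  move=> B; have [BS|] := boolP (B \in Sigma); last by exists 0.
  have [->|BA] := eqVneq B A; first by exists 0.
  by have [u uP] := rank_le1_image (rank_le1 B BS BA); exists u.
have /choice[p pP] := @extreme_points_line _ _ (P_ Sigma a k).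
pose q j B := p (iter (k - j.+1) (mulmx A) (u B)).
(* All candidates: the point of the word [A^k], then two points for each line, indexed by position
   [j] and letter [B]. *)
pose s := iter k (mulmx A) a ::
  ([seq (q j B).1 | j <- iota 0 k, B <- Sigma] ++
   [seq (q j B).2 | j <- iota 0 k, B <- Sigma]).
apply: (@le_trans _ _ (size s)%:R%:E).
  apply: counting_le_size => x Ex.
  have [T [TS xE]] := Eorbit x Ex; rewrite /= inE mem_cat.
  have [E'|[j [y [jk TjA E']]]] := apply_word_factor A T a k.
    by rewrite xE E' eqxx.
  have TjS := TS j jk.
  have [t tE] := uP _ TjS TjA y.
  rewrite tE iter_mulmxZ in E'.
  have := pP (iter (k - j.+1) (mulmx A) (u (T j))) t.
  rewrite -E' -xE => /(_ Ex)[] ->; apply/orP; right; apply/orP; [left|right];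
    by apply/allpairsP; exists (j, T j); rewrite mem_iota.
rewrite lee_fin -natrM ler_nat /s /= size_cat !size_allpairs size_iota mulnC.
by rewrite mulSn mul2n -addnn -add1n leq_add2r muln_gt0 Sigma_gt0.
Qed.

Theorem proposition5 (R : realType) :
  exists (C : R) (k0 : nat), 0 < C /\
    forall (n m : nat) (Sigma : {fset 'M[R]_n}),
      #|` Sigma| = m ->
      (#|` [fset T in Sigma | (1 < \rank T)%N]%fset| <= 1)%N ->
      oligo_vertex Sigma /\
      forall k : nat, (k0 <= k)%N -> (N_ Sigma k <= (C * (m * k)%:R)%:E)%E.
Proof.
exists 3, 1%N; split=> // n m Sigma <- large.
have [A rank_le1] : exists A : 'M[R]_n,
    forall B, B \in Sigma -> B != A -> (\rank B <= 1)%N.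
  (* It suffices to enclose the letters of rank above one in a singleton; if there are none, [A = 0]
     serves. *)
  suff [A sA] : exists A,
      ([fset T in Sigma | (1 < \rank T)%N] `<=` [fset A])%fset.
    exists A => B BS; apply: contraR; rewrite -ltnNge => rB.
    by have /fsubsetP/(_ B) := sA; rewrite !inE BS rB; apply.
  move: large; rewrite leq_eqVlt ltnS leqn0 => /orP[/cardfs1P[A ->]|].
    by exists A.
  by rewrite cardfs_eq0 => /eqP->; exists 0; exact: fsub0set.
have bound k : (0 < k)%N -> (N_ Sigma k <= (3 * (#|` Sigma| * k)%:R)%:E)%E.
  by move=> k0; apply: ge_ereal_sup => _ [a _ <-]; exact: (N_at_le a rank_le1).
(* The added 1 keeps [alpha] positive even for empty [Sigma]; the exponent is [d = 1]. *)
split=> //; exists (3 * #|` Sigma|%:R + 1), 1%N, 1; split=> //.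
move=> k k0; apply: le_trans (bound k k0) _.
by rewrite lee_fin powRr1// natrM mulrA ler_wpM2r// lerDl.
Qed.
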